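(* Let $\alpha_1$ and $\alpha_2$ be cocycles defined on the dynamical systems $(X_1,\mathcal B_1,\mu_1,\Gamma_1)$ and $(X_2,\mathcal B_2,\mu_2,\Gamma_2)$ respectively, with values in a group $G$ equipped with a subadditive function $\theta$. Assume $\alpha_1$ and $\alpha_2$ are weakly equivalent through an isomorphism $h:X_1\to X_2$. If $\gamma_1\in\Gamma_1$ and $\gamma_2=h\gamma_1h^{-1}$ are such that the maps $x_1\mapsto\theta(\alpha_1(x_1,\gamma_1))$ and $x_2\mapsto\theta(\alpha_2(x_2,\gamma_2))$ are integrable on $X_1$ and $X_2$ respectively, then $\Theta_{\mu_1}(\gamma_1,\alpha_1)=\Theta_{\mu_2}(\gamma_2,\alpha_2)$.
   Context: For a probability space $(X,\mathcal B,\mu)$, $\mathrm{Aut}(X,\mu)$ is the group of invertible measure-preserving transformations; $\Gamma_i$ is a subgroup of $\mathrm{Aut}(X_i,\mu_i)$. A measurable map $\alpha:X\times\Gamma\to G$ is a cocycle if for all $\gamma_1,\gamma_2\in\Gamma$ and $\mu$-a.e. $x$, $\alpha(x,\gamma_1\gamma_2)=\alpha(x,\gamma_1)\alpha(\gamma_1x,\gamma_2)$. A subadditive function on $G$ is a continuous $\theta:G\to\mathbb R^+$ with $\theta(g_1g_2)\le\theta(g_1)+\theta(g_2)$. Two cocycles $\alpha,\beta$ on the same system are cohomologous if there is a measurable $\phi:X\to G$ with $\beta(x,\gamma)=\phi(x)\alpha(x,\gamma)(\phi(\gamma x))^{-1}$ for all $\gamma\in\Gamma$ and $\mu$-a.e.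 $x$. An isomorphism $h:X_1\to X_2$ is an invertible transformation carrying $\mu_1$ onto $\mu_2$; for a cocycle $\alpha_1$ on $(X_1,\mathcal B_1,\mu_1,\Gamma_1)$ and $\Gamma_2=h\Gamma_1h^{-1}$, $h\circ\alpha_1$ is the cocycle on $(X_2,\mathcal B_2,\mu_2,\Gamma_2)$ given by $h\circ\alpha_1(x_2,\gamma_2)=\alpha_1(h^{-1}(x_2),h^{-1}\gamma_2h)$. The cocycles $\alpha_1,\alpha_2$ are weakly equivalent (through $h$) if $\Gamma_2=h\Gamma_1h^{-1}$ and $\alpha_2$ and $h\circ\alpha_1$ are cohomologous. If $x\mapsto\theta(\alpha(x,\gamma))$ is integrable, then for $\mu$-a.e. $x$ the limit $\Theta(x,\gamma,\alpha)=\lim_{n\to\infty}\frac1n\theta(\alpha(x,\gamma^n))$ exists and is integrable, and $\Theta_\mu(\gamma,\alpha):=\int\Theta(x,\gamma,\alpha)\,d\mu$. *)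

(* Defs.v *)
From HB Require Import structures.
From mathcomp Require Import all_boot all_order all_algebra.
From mathcomp Require Import all_classical all_reals all_analysis.
Set Implicit Arguments. Unset Strict Implicit. Unset Printing Implicit Defensive.
Import Order.TTheory GRing.Theory Num.Theory numFieldNormedType.Exports.
Local Open Scope classical_set_scope.
Local Open Scope ring_scope.

Record topgroup (G : topologicalType) (mul : G -> G -> G) (inv : G -> G)
    (one : G) : Prop := TopGroup {
  tg_mulA : forall a b c, mul a (mul b c) = mul (mul a b) c;
  tg_mul1g : forall a, mul one a = a;
  tg_mulg1 : forall a, mul a one = a;
  tg_mulVg : forall a, mul (inv a) a = one;
  tg_mulgV : forall a, mul a (inv a) = one;
  tg_mul_cont : continuous (fun p : G * G => mul p.1 p.2);
  tg_inv_cont : continuous inv }.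

Definition subadditive_fun (R : realType) (G : topologicalType)
    (mul : G -> G -> G) (theta : G -> R) : Prop :=
  continuous theta /\ (forall g, 0 <= theta g) /\
  (forall g1 g2, theta (mul g1 g2) <= theta g1 + theta g2).

Definition borel_meas d (X : measurableType d) (G : topologicalType)
    (f : X -> G) : Prop :=
  forall U : set G, open U -> measurable (f @^-1` U).

Definition mpt d (R : realType) (X : measurableType d)
    (mu : probability X R) (T : X -> X) : Prop :=
  measurable_fun setT T /\
  forall A, measurable A -> mu (T @^-1` A) = mu A.

Definition is_aut d (R : realType) (X : measurableType d)
    (mu : probability X R) (g : X -> X) : Prop :=
  exists g' : X -> X, cancel g g' /\ cancel g' g /\ mpt mu g /\ mpt mu g'.

(* Gamma : a subgroup of Aut(X, mu).  The group law is written so that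
   (g1 g2) x = g2 (g1 x). *)
Definition gmul (X : Type) (g1 g2 : X -> X) : X -> X := g2 \o g1.

Definition aut_subgroup d (R : realType) (X : measurableType d)
    (mu : probability X R) (Gam : set (X -> X)) : Prop :=
  (forall g, Gam g -> is_aut mu g) /\ Gam id /\
  (forall g1 g2, Gam g1 -> Gam g2 -> Gam (gmul g1 g2)) /\
  (forall g g', Gam g -> cancel g g' -> cancel g' g -> Gam g').

Definition cocycle d (R : realType) (X : measurableType d)
    (mu : probability X R) (Gam : set (X -> X)) (G : topologicalType)
    (mul : G -> G -> G) (alpha : X -> (X -> X) -> G) : Prop :=
  (forall g, Gam g -> borel_meas (fun x => alpha x g)) /\
  (forall g1 g2, Gam g1 -> Gam g2 ->
     {ae mu, forall x, alpha x (gmul g1 g2) = mul (alpha x g1) (alpha (g1 x) g2)}).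

Definition cohomologous d (R : realType) (X : measurableType d)
    (mu : probability X R) (Gam : set (X -> X)) (G : topologicalType)
    (mul : G -> G -> G) (inv : G -> G) (alpha beta : X -> (X -> X) -> G) : Prop :=
  exists phi : X -> G, borel_meas phi /\
    forall g, Gam g ->
      {ae mu, forall x, beta x g = mul (mul (phi x) (alpha x g)) (inv (phi (g x)))}.

Definition isomorphism d1 d2 (R : realType) (X1 : measurableType d1)
    (X2 : measurableType d2) (mu1 : probability X1 R) (mu2 : probability X2 R)
    (h : X1 -> X2) (hi : X2 -> X1) : Prop :=
  cancel h hi /\ cancel hi h /\
  measurable_fun setT h /\ measurable_fun setT hi /\
  forall A, measurable A -> mu1 (h @^-1` A) = mu2 A.

Definition conj_group (X1 X2 : Type) (h : X1 -> X2) (hi : X2 -> X1)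
    (Gam1 : set (X1 -> X1)) : set (X2 -> X2) :=
  [set g2 | exists2 g1, Gam1 g1 & g2 = h \o g1 \o hi].

Definition transport (X1 X2 : Type) (G : Type) (h : X1 -> X2) (hi : X2 -> X1)
    (alpha1 : X1 -> (X1 -> X1) -> G) : X2 -> (X2 -> X2) -> G :=
  fun x2 g2 => alpha1 (hi x2) (hi \o g2 \o h).

Definition weakly_equivalent d1 d2 (R : realType) (X1 : measurableType d1)
    (X2 : measurableType d2) (mu1 : probability X1 R) (mu2 : probability X2 R)
    (Gam1 : set (X1 -> X1)) (Gam2 : set (X2 -> X2)) (G : topologicalType)
    (mul : G -> G -> G) (inv : G -> G)
    (alpha1 : X1 -> (X1 -> X1) -> G) (alpha2 : X2 -> (X2 -> X2) -> G)
    (h : X1 -> X2) (hi : X2 -> X1) : Prop :=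
  isomorphism mu1 mu2 h hi /\ Gam2 = conj_group h hi Gam1 /\
  cohomologous mu2 Gam2 mul inv (transport h hi alpha1) alpha2.

Definition Theta (R : realType) (X : Type) (G : Type) (theta : G -> R)
    (alpha : X -> (X -> X) -> G) (g : X -> X) (x : X) : R :=
  limn (fun n : nat => theta (alpha x (iter n g)) / n%:R).

Definition Theta_mu d (R : realType) (X : measurableType d)
    (mu : probability X R) (G : Type) (theta : G -> R)
    (alpha : X -> (X -> X) -> G) (g : X -> X) : \bar R :=
  (\int[mu]_x (Theta theta alpha g x)%:E)%E.

(* Main.v *)
Require Import Defs.
From HB Require Import structures.
From mathcomp Require Import all_boot all_order all_algebra.
From mathcomp Require Import all_classical all_reals all_analysis.
From mathcomp Require Import measurable_realfun lra ring.
Set Implicit Arguments. Unset Strict Implicit. Unset Printing Implicit Defensive.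
Import Order.TTheory GRing.Theory Num.Theory numFieldNormedType.Exports.
Local Open Scope classical_set_scope.
Local Open Scope ring_scope.

(* Cohomology through [phi] bounds [theta (alpha2 (h x) (gam2 ^ n))] by
   [theta (alpha1 x (gam1 ^ n))] plus [theta (phi (h x))] plus a term
   [psi (gam2 ^ n (h x))], with [psi = theta \o inv \o phi], and conversely.
   Almost every orbit returns infinitely often to a set where [psi] is bounded,
   so the extra terms, divided by [n], vanish along a subsequence: the limits
   agree wherever both exist.  As [Theta] is the junk value [0] where its limit
   does not exist, almost everywhere convergence is needed as well; it is
   Kingman's subadditive ergodic theorem for nonnegative [f].  If
   [liminf f_n / n < p] on an invariant set, cutting orbits into blocks along
   which [f] grows at rate at most [p] gives
   [f_n <= p * n + S_n (cost_N) + N ^ 2], where [S_n] are ergodic sums and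
   [cost_N] is [f_1] on the points that have no such block of length at most
   [N].  Since [cost_N] tends to [0] in [L^1], the maximal ergodic inequality
   yields [limsup f_n / n <= p]. *)

(** * Ergodic sums and greedy cutting of orbits *)

Definition ergodic_sum {X : Type} {R : pzRingType} (T : X -> X) (h : X -> R)
    (n : nat) (x : X) : R := \sum_(k < n) h (iter k T x).

Section ErgodicSums.
Context {X : Type} {R : realType} (T : X -> X).
Implicit Types (h : X -> R) (f : nat -> X -> R).

Lemma ergodic_sumS h n x :
  ergodic_sum T h n.+1 x = h x + ergodic_sum T h n (T x).
Proof.
rewrite /ergodic_sum big_ord_recl; congr (_ + _).
by apply: eq_bigr => i _ /=; rewrite -iterSr.
Qed.

Lemma ergodic_sumD h m n x :
  ergodic_sum T h (m + n) x
  = ergodic_sum T h m x + ergodic_sum T h n (iter m T x).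
Proof.
elim: m x => [|m IH] x; first by rewrite /ergodic_sum big_ord0 add0r.
by rewrite addSn !ergodic_sumS IH addrA -iterSr.
Qed.

Lemma ergodic_sum_ge0 h n x : (forall y, 0 <= h y) -> 0 <= ergodic_sum T h n x.
Proof. by move=> h0; apply: sumr_ge0. Qed.

Lemma ergodic_sum_le_bound h (c : R) n x :
  (forall y, h y <= c) -> ergodic_sum T h n x <= n%:R * c.
Proof.
move=> hc; apply: le_trans (ler_sum _ (fun i _ => hc _)) _.
by rewrite sumr_const card_ord mulr_natl.
Qed.

(** Bounding the block length by [N] means that a block started inside an orbit segment overshoots
    it by fewer than [N] steps. *)
Definition maximal_set h (c : R) (N : nat) : set X :=
  [set x | exists m, (0 < m <= N)%N /\ c * m%:R <= ergodic_sum T h m x].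

(* Greedily cover the visits to [maximal_set] by blocks of length at most [N]
   on which the average of [h] is at least [c]. *)
Lemma ergodic_sum_maximal_set h (c : R) N n x : (forall y, 0 <= h y) -> 0 <= c ->
  c * ergodic_sum T (\1_(maximal_set h c N)) n x <= ergodic_sum T h (n + N) x.
Proof.
move=> h0 c0; have [k] := ubnP n; elim: k n x => // k IH [|n] x.
  by move=> _; rewrite {1}/ergodic_sum big_ord0 mulr0 ergodic_sum_ge0.
rewrite ltnS => nk.
have [[m [/andP[m0 mN] cm]]|xA] := pselect (maximal_set h c N x); last first.
  rewrite addSn !ergodic_sumS indicE memNset // add0r.
  by apply: le_trans (IH _ _ nk) _; rewrite lerDr.
(* If the block reaches the end of the segment, it covers all remaining visits, at most [n.+1 <= m]
   of them; the slack of [N] steps makes room for it. *)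
have [nm|mn] := leqP n.+1 m.
  have -> : (n.+1 + N = m + (n.+1 + N - m))%N.
    by rewrite subnKC // (leq_trans mN) // leq_addl.
  rewrite ergodic_sumD; apply: le_trans (_ : c * m%:R <= _).
    apply: ler_wpM2l => //; apply: le_trans (_ : n.+1%:R * 1 <= _).
      by apply: ergodic_sum_le_bound => y; rewrite indicE lern1 leq_b1.
    by rewrite mulr1 ler_nat.
  by apply: le_trans cm _; rewrite lerDl ergodic_sum_ge0.
have -> : n.+1 = (m + (n.+1 - m))%N by rewrite subnKC // ltnW.
rewrite -addnA !(ergodic_sumD _ m) mulrDr; apply: lerD; last first.
  by apply: IH; rewrite (leq_trans _ nk) // ltn_subrL m0.
apply: le_trans cm; apply: ler_wpM2l => //.
rewrite -[leRHS]mulr1.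
by apply: ergodic_sum_le_bound => y; rewrite indicE lern1 leq_b1.
Qed.

(* Cut the orbit segment of length [n] greedily into blocks of length [m <= N]
   along which [f m <= p * m]; a point that starts no such block takes a single
   step, paid for by [h], and the last [N] steps cost at most [h + N] each. *)
Lemma subadditive_le_ergodic_sum f (D : set X) (p : R) h N n x :
  (forall y, D y -> D (T y)) ->
  (forall y, 0 <= h y) -> 0 <= p ->
  (forall k m y, D y -> f (k + m)%N y <= f k y + f m (iter k T y)) ->
  (forall y, D y -> f 1 y <= h y \/
     f 1 y <= N%:R /\ exists2 m, (0 < m <= N)%N & f m y <= p * m%:R) ->
  (0 < n)%N -> D x -> f n x <= p * n%:R + ergodic_sum T h n x + N%:R * N%:R.
Proof.
move=> DT h0 p0 fD hh.
have Diter k y : D y -> D (iter k T y).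
  by move=> Dy; elim: k => //= k; apply: DT.
have f1 y : D y -> f 1 y <= h y + N%:R.
  by case/hh => [fy|[fy _]]; apply: le_trans fy _; rewrite ?lerDl ?lerDr.
have fle k y : D y -> f k.+1 y <= ergodic_sum T h k.+1 y + k.+1%:R * N%:R.
  elim: k y => [|k IH] y Dy.
    by rewrite ergodic_sumS /ergodic_sum big_ord0 addr0 mul1r f1.
  apply: le_trans (fD 1 k.+1 y Dy) _.
  have := IH _ (DT _ Dy); have := f1 _ Dy.
  rewrite /= (ergodic_sumS h k.+1) [X in _ + X * _]mulrS mulrDl mul1r; lra.
have [k] := ubnP n; elim: k n x => // k IH [//|n] x; rewrite ltnS => nk _ Dx.
have [nN|Nn] := leqP n.+1 N.
  apply: le_trans (fle _ _ Dx) _; rewrite lerD //.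
    by rewrite lerDr mulr_ge0.
  by rewrite ler_wpM2r // ler_nat.
case: (hh _ Dx) => [fx|[_ [m /andP[m0 mN] fm]]].
  (* Length one is treated apart because nothing bounds [f 0] from above, so the induction may only
     fall back on positive lengths. *)
  case: n nk Nn => [|n] nk Nn.
    rewrite ergodic_sumS /ergodic_sum big_ord0 addr0.
    have : 0 <= (N%:R * N%:R : R) by rewrite mulr_ge0.
    lra.
  have := IH n.+1 (T x) nk isT (DT _ Dx).
  have := fD 1 n.+1 x Dx.
  rewrite /= (ergodic_sumS h n.+1) [X in _ <= _ * X + _ + _]mulrS mulrDr mulr1; lra.
have mn : (m < n.+1)%N by exact: leq_ltn_trans Nn.
have [r nE r0] : exists2 r, n.+1 = (m + r)%N & (0 < r)%N.
  by exists (n.+1 - m)%N; rewrite ?subn_gt0 // subnKC // ltnW.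
have rk : (r < k)%N.
  by apply: leq_trans nk; rewrite nE -[ltnLHS]add0n ltn_add2r.
have := IH _ (iter m T x) rk r0 (Diter _ _ Dx); have := fD m r x Dx.
have := ergodic_sum_ge0 m x h0.
rewrite nE ergodic_sumD natrD mulrDr; lra.
Qed.
End ErgodicSums.

(** * Measure-preserving maps and level sets *)

Section MeasurePreserving.
Context {R : realType} d1 d2 (X : measurableType d1) (Y : measurableType d2).
Variables (mu : {measure set X -> \bar R}) (nu : {measure set Y -> \bar R}).
Variable phi : X -> Y.
Hypothesis mphi : measurable_fun setT phi.
Hypothesis phi_mu : forall A, measurable A -> mu (phi @^-1` A) = nu A.

Lemma ge0_integral_measure_preserving (f : Y -> \bar R) :
  measurable_fun setT f -> (forall y, (0 <= f y)%E) ->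
  (\int[mu]_x f (phi x) = \int[nu]_y f y)%E.
Proof.
move=> mf f0.
have := ge0_integral_pushforward mphi mu measurableT mf (fun y _ => f0 y).
rewrite preimage_setT /= => <-.
by apply: (@eq_measure_integral _ _ _ _ nu) => A mA _; rewrite -phi_mu.
Qed.

Lemma ae_measure_preserving (P : Y -> Prop) :
  {ae nu, forall y, P y} -> {ae mu, forall x, P (phi x)}.
Proof.
case=> A [mA A0 PA]; exists (phi @^-1` A); split.
- by rewrite -[X in measurable X]setTI; exact: mphi.
- by rewrite phi_mu.
- by move=> x Px; exact: PA.
Qed.

End MeasurePreserving.

Section SublevelSets.
Context {R : realType} d (X : measurableType d).
Implicit Types f : X -> R.

Lemma measurable_superlevel f a :
  measurable_fun setT f -> measurable [set x | a <= f x].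
Proof.
by move=> mf; rewrite -preimage_itvcy -[X in measurable X]setTI; exact: mf.
Qed.

Lemma measurable_sublevel f a :
  measurable_fun setT f -> measurable [set x | f x <= a].
Proof.
by move=> mf; rewrite -preimage_itvNyc -[X in measurable X]setTI; exact: mf.
Qed.

End SublevelSets.

(** * Maximal ergodic inequality *)

Section MaximalInequality.
Context {R : realType} d (X : measurableType d) (mu : probability X R).
Variable T : X -> X.
Hypothesis T_mpt : mpt mu T.

Lemma mpt_iter k : mpt mu (iter k T).
Proof.
elim: k => [|k [mTk Tk]]; first by split=> //; exact: measurable_id.
have [mT TE] := T_mpt; split; first exact: measurableT_comp mT mTk.
move=> A mA; rewrite -(TE A mA) -[RHS]Tk //.
by rewrite -[X in measurable X]setTI; exact: mT.
Qed.

Lemma measurable_ergodic_sum (h : X -> R) n :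
  measurable_fun setT h -> measurable_fun setT (ergodic_sum T h n).
Proof.
move=> mh; apply: measurable_sum => k.
exact: measurableT_comp mh (mpt_iter k).1.
Qed.

Lemma integral_ergodic_sum (h : X -> R) n :
  measurable_fun setT h -> (forall x, 0 <= h x) ->
  (\int[mu]_x (ergodic_sum T h n x)%:E = n%:R%:E * \int[mu]_x (h x)%:E)%E.
Proof.
move=> mh h0.
under eq_integral do rewrite /ergodic_sum -sumEFin.
rewrite ge0_integral_sum //.
- rewrite (eq_bigr (fun=> \int[mu]_x (h x)%:E)%E) => [|k _].
    by rewrite sumr_const card_ord mule_natl.
  have [mTk Tk] := mpt_iter k.
  apply: (ge0_integral_measure_preserving mTk Tk (f := EFin \o h)).
    exact/measurable_EFinP.
  by move=> x; rewrite lee_fin.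
- move=> k; apply/measurable_EFinP; exact: measurableT_comp mh (mpt_iter k).1.
- by move=> k x _; rewrite lee_fin.
Qed.

Lemma measurable_maximal_set (h : X -> R) c N :
  measurable_fun setT h -> measurable (maximal_set T h c N).
Proof.
move=> mh.
rewrite (_ : maximal_set T h c N =
  \bigcup_(m in [set m | (0 < m <= N)%N])
    [set x | c * m%:R <= ergodic_sum T h m x]).
  apply: bigcup_measurable => m _; apply: measurable_superlevel.
  exact: measurable_ergodic_sum.
by apply/seteqP; split=> x [m]; [case=> mN cm|move=> mN cm]; exists m.
Qed.

(** Integrating [ergodic_sum_maximal_set] and using invariance gives [n * c * mu A <= (n + N) * I],
    with [I] the integral of [h]; letting [n] grow removes [N]. *)
Lemma maximal_ergodic_inequality (h : X -> R) c N :
  measurable_fun setT h -> (forall x, 0 <= h x) -> 0 <= c ->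
  (c%:E * mu (maximal_set T h c N) <= \int[mu]_x (h x)%:E)%E.
Proof.
move=> mh h0 c0; set A := maximal_set T h c N.
have mA : measurable A by exact: measurable_maximal_set.
have m1A : measurable_fun setT (\1_A : X -> R) by exact: measurable_indic.
have key n : (n%:R%:E * (c%:E * mu A) <= (n + N)%:R%:E * \int[mu]_x (h x)%:E)%E.
  rewrite -(setIT A) -(integral_indic mu measurableT mA).
  rewrite -integral_ergodic_sum // muleCA -integral_ergodic_sum //.
  rewrite -ge0_integralZl_EFin //.
  - apply: ge0_le_integral => //.
    + by move=> x _; rewrite lee_fin mulr_ge0 // ergodic_sum_ge0.
    + apply/measurable_EFinP; apply: measurable_funM => //.
      exact: measurable_ergodic_sum.
    + by apply/measurable_EFinP; exact: measurable_ergodic_sum.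
    + by move=> x _; rewrite lee_fin; exact: ergodic_sum_maximal_set.
  - by move=> x _; rewrite lee_fin ergodic_sum_ge0.
  - by apply/measurable_EFinP; exact: measurable_ergodic_sum.
have I0 : (0 <= \int[mu]_x (h x)%:E)%E.
  by apply: integral_ge0 => x _; rewrite lee_fin.
have muA : mu A \is a fin_num by exact: fin_num_measure.
move: key I0; rewrite -(fineK muA).
case: (\int[mu]_x (h x)%:E)%E => [i key|_ _|_]; [|by rewrite leey|by []].
rewrite !lee_fin => i0; rewrite leNgt; apply/negP => lt.
(* An excess [e > 0] would give [n * e <= N * i] for all [n], which fails at the first integer
   beyond [N * i / e]. *)
set e := c * fine (mu A) - i; have e0 : 0 < e by rewrite subr_gt0.
have := key (Num.truncn (N%:R * i / e)).+1.
rewrite -!EFinM lee_fin natrD.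
have := truncnS_gt (N%:R * i / e); rewrite ltr_pdivrMr //.
rewrite /e; lra.
Qed.

End MaximalInequality.

Section MaximalFunction.
Context {R : realType} d (X : measurableType d) (mu : probability X R).
Variable T : X -> X.
Hypothesis T_mpt : mpt mu T.

Definition maximal_bigcup (h : X -> R) (c : R) : set X :=
  \bigcup_N maximal_set T h c N.

Lemma measurable_maximal_bigcup (h : X -> R) c :
  measurable_fun setT h -> measurable (maximal_bigcup h c).
Proof.
by move=> mh; apply: bigcup_measurable => N _; exact: (measurable_maximal_set T_mpt).
Qed.

Lemma maximal_ergodic_inequality_bigcup (h : X -> R) c :
  measurable_fun setT h -> (forall x, 0 <= h x) -> 0 <= c ->
  (c%:E * mu (maximal_bigcup h c) <= \int[mu]_x (h x)%:E)%E.
Proof.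
move=> mh h0 c0.
have cvW : (c%:E * (mu \o maximal_set T h c) N)%E @[N --> \oo] -->
    (c%:E * mu (maximal_bigcup h c))%E.
  apply: cvgeZl => //; apply: nondecreasing_cvg_mu.
  - by move=> N; exact: (measurable_maximal_set T_mpt).
  - exact: measurable_maximal_bigcup.
  - move=> N M NM; apply/subsetPset => x [m [/andP[m0 mN] cm]].
    by exists m; split=> //; rewrite m0 (leq_trans mN).
apply: (cvge_to_le cvW); apply: nearW => N /=.
exact: (maximal_ergodic_inequality T_mpt N mh h0 c0).
Qed.

(** An exceptional point lies in [maximal_bigcup h K] for every [K], a set of measure at most the
    integral of [h] divided by [K] when [K > 0]. *)
Lemma ae_ergodic_sum_le (h : X -> R) :
  measurable_fun setT h -> (forall x, 0 <= h x) ->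
  mu.-integrable setT (EFin \o h) ->
  {ae mu, forall x, exists K : nat, forall n, (0 < n)%N ->
     ergodic_sum T h n x <= K%:R * n%:R}.
Proof.
move=> mh h0 ih; set B := \bigcap_K maximal_bigcup h K%:R.
have mB : measurable B.
  by apply: bigcap_measurable => // K _; exact: measurable_maximal_bigcup.
exists B; split=> //; last first.
  move=> x /= nK K _; apply: contrapT => xK; apply: nK; exists K => n n0.
  rewrite leNgt; apply/negP => lt; apply: xK; exists n => //; exists n.
  by rewrite n0 leqnn; split=> //; exact: ltW.
have le K : (K%:R%:E * mu B <= \int[mu]_x (h x)%:E)%E.
  apply: le_trans (maximal_ergodic_inequality_bigcup mh h0 (ler0n R K)).
  apply: lee_wpmul2l; rewrite ?lee_fin //.
  apply: le_measure; rewrite ?inE //; first exact: measurable_maximal_bigcup.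
  by move=> x; apply.
move: le; rewrite -(fineK (integrable_fin_num measurableT ih)).
have muB : mu B \is a fin_num by exact: fin_num_measure.
rewrite -(fineK muB); move: (fine_ge0 (measure_ge0 mu B)).
set b := fine (mu B); set i := fine _ => b0 le.
apply/eqP; rewrite eqe eq_le b0 andbT leNgt; apply/negP => b_gt0.
have := le (Num.truncn (i / b)).+1.
by rewrite -EFinM lee_fin leNgt -ltr_pdivrMr // truncnS_gt.
Qed.

End MaximalFunction.

(** * From rate [p] infinitely cheaply to any rate [q > p] *)

Section Upcrossing.
Context {R : realType} d (X : measurableType d) (mu : probability X R).
Variable T : X -> X.
Hypothesis T_mpt : mpt mu T.
Variables (f : nat -> X -> R) (D : set X) (p q : R).
Hypothesis mf : forall n, measurable_fun setT (f n).
Hypothesis f0 : forall n x, 0 <= f n x.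
Hypothesis if1 : mu.-integrable setT (EFin \o f 1).
Hypothesis mD : measurable D.
Hypothesis DT : forall x, D x -> D (T x).
Hypothesis fD : forall k m x, D x -> f (k + m)%N x <= f k x + f m (iter k T x).
Hypothesis p0 : 0 <= p.
Hypothesis pq : p < q.
Hypothesis fp : forall x, D x -> exists2 m, (0 < m)%N & f m x <= p * m%:R.

(** The condition [f 1 x <= N] bounds a single step at a good point, for use near the end of a
    segment where its block no longer fits. *)
Let good N : set X := [set x | f 1 x <= N%:R] `&`
  \bigcup_(m in [set m | (0 < m <= N)%N]) [set x | f m x <= p * m%:R].

Let cost N : X -> R := f 1 \* \1_(D `\` good N).

Let measurable_cost N : measurable_fun setT (cost N).
Proof.
apply: measurable_funM => //; apply: measurable_indic.
apply: measurableD => //; apply: measurableI; first exact: measurable_sublevel.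
by apply: bigcup_measurable => m _; exact: measurable_sublevel.
Qed.

Let cost_ge0 N x : 0 <= cost N x.
Proof. by rewrite mulr_ge0 // indicE. Qed.

Let cost_le N x : cost N x <= f 1 x.
Proof. by rewrite /cost /= ler_piMr // indicE lern1 leq_b1. Qed.

(** By [fp], a point of [D] is good once [N] exceeds both [f 1 x] and the length of its block. *)
Let cost_cvg0 x : (cost N x)%:E @[N --> \oo] --> 0%E.
Proof.
apply: cvg_near_cst.
have [Dx|nDx] := pselect (D x); last first.
  by apply: nearW => N; rewrite /cost /= indicE memNset ?mulr0 // => -[].
have [m m0 fm] := fp Dx; near=> N.
rewrite /cost /= indicE memNset ?mulr0 // => -[_]; apply; split.
  by rewrite /=; near: N; exact: nbhs_infty_ger.
by exists m => //=; rewrite m0 /=; near: N; exact: nbhs_infty_ge.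
Unshelve. all: by end_near. Qed.

Let integral_cost_cvg0 : (\int[mu]_x (cost N x)%:E)%E @[N --> \oo] --> 0%E.
Proof.
rewrite -[X in _ --> X](@integral0 _ _ _ mu setT).
apply: (@dominated_cvg _ _ _ mu setT measurableT _ _ (EFin \o f 1)) => //.
- by move=> N; apply/measurable_EFinP.
- by move=> x _; exact: cost_cvg0.
- by move=> N x _; rewrite /= lee_fin ger0_norm.
Qed.

(** Half of the gap [q - p] absorbs the constant [N ^ 2] for large [n]; so if [f n x >= q * n]
    infinitely often, the averages of [cost N] reach the other half, for every [N]. By the maximal
    inequality such points form a null set, as the integrals of [cost N] tend to [0]. *)
Lemma ae_eventually_lt :
  {ae mu, forall x, D x -> \forall n \near \oo, f n x < q * n%:R}.
Proof.
set c := (q - p) / 2.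
have c0 : 0 < c by rewrite divr_gt0 // subr_gt0.
set W := \bigcap_N maximal_bigcup T (cost N) c.
have mW : measurable W.
  by apply: bigcap_measurable => // N _; exact: (measurable_maximal_bigcup T_mpt).
exists W; split=> //.
  have le N : (c%:E * mu W <= \int[mu]_x (cost N x)%:E)%E.
    apply: le_trans (maximal_ergodic_inequality_bigcup T_mpt
      (measurable_cost N) (cost_ge0 N) (ltW c0)).
    rewrite lee_pmul2l //; apply: le_measure => //; rewrite ?inE //.
      exact: (measurable_maximal_bigcup T_mpt).
    by move=> x; apply.
  have : (c%:E * mu W <= 0)%E.
    by apply: (cvge_to_ge integral_cost_cvg0); exact: nearW.
  rewrite pmule_rle0 ?lte_fin // => W0.
  by apply/eqP; rewrite eq_le W0 measure_ge0.
move=> x /= /not_implyP[Dx xq] N _.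
have [n [n1 cn fn]] : exists n,
    [/\ (0 < n)%N, N%:R * N%:R <= c * n%:R & q * n%:R <= f n x].
  apply: contrapT => nn; apply: xq; near=> n.
  rewrite ltNge; apply/negP => fn; apply: nn; exists n; split => //.
    by near: n; exact: nbhs_infty_gt.
  rewrite [leRHS]mulrC -ler_pdivrMr //; near: n; exact: nbhs_infty_ger.
exists n => //; exists n; rewrite n1 leqnn; split => //.
have goodP y : D y -> f 1 y <= cost N y \/
    f 1 y <= N%:R /\ exists2 m, (0 < m <= N)%N & f m y <= p * m%:R.
  move=> Dy; have [[? [m mN ?]]|ngood] := pselect (good N y).
    by right; split=> //; exists m.
  by left; rewrite /cost /= indicE mem_set // mulr1.
have := subadditive_le_ergodic_sum DT (cost_ge0 N) p0 fD goodP n1 Dx.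
rewrite /c in cn *; lra.
Unshelve. all: by end_near. Qed.

End Upcrossing.

(** * Kingman's subadditive ergodic theorem *)

Section Kingman.
Context {R : realType}.

(** On the grid of mesh [1 / (k + 1)], take the least rate below which [a] falls by every margin
    [M]. The third hypothesis bounds [a n / n] above by the next grid rate, minimality bounds it
    below, and the window shrinks with the mesh. *)
Lemma is_cvg_no_upcrossing (a : nat -> R) (K : nat) :
  (forall n, 0 <= a n) -> (forall n, (0 < n)%N -> a n <= K%:R * n%:R) ->
  (forall i k : nat,
     (forall M : nat,
        exists2 m, (0 < m)%N & a m <= i%:R / k.+1%:R * m%:R - M%:R) ->
     \forall n \near \oo, a n < i.+1%:R / k.+1%:R * n%:R) ->
  cvgn (fun n => a n / n%:R).
Proof.
move=> a0 aK aup; apply/cauchy_cvgP/cauchy_exP => e e0.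
have [k ke] : exists k : nat, 2 / k.+1%:R < e.
  exists (Num.truncn (2 / e)); rewrite ltr_pdivrMr // mulrC -ltr_pdivrMr //.
  exact: truncnS_gt.
set dl := k.+1%:R^-1 in ke; have dl0 : 0 < dl by rewrite invr_gt0.
pose P (i : nat) := forall M : nat,
  exists2 m, (0 < m)%N & a m <= i%:R * dl * m%:R - M%:R.
have exP : exists i, `[< P i >].
  (* This grid rate is [K + 1]; at [m = M + 1] it exceeds the bound [K * m] by [M + 1]. *)
  exists (K.+1 * k.+1)%N; apply/asboolP => M; exists M.+1 => //.
  rewrite natrM mulfK //; apply: le_trans (aK _ _) _ => //.
  rewrite [K.+1%:R]mulrS [M.+1%:R]mulrS; lra.
have [i /asboolP Pi imin] := ex_minnP exP.
(* One mesh width is lost because minimality speaks of the preceding grid rate, a second one to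
   absorb the margin [M] for large [n]. If [i = 0], the bound is nonpositive. *)
have lower : \forall n \near \oo, (i%:R - 2) * dl * n%:R <= a n.
  case: i Pi imin => [_ _|i Pi imin].
    apply: nearW => n; apply: le_trans (a0 n).
    by rewrite sub0r !mulNr oppr_le0 !mulr_ge0 // ltW.
  have /existsNP[M nM] : ~ P i by move/asboolP/imin; rewrite ltnn.
  near=> n.
  have n0 : (0 < n)%N by near: n; exact: nbhs_infty_gt.
  have Mn : M%:R <= dl * n%:R.
    rewrite mulrC -ler_pdivrMr //; near: n; exact: nbhs_infty_ger.
  have : i%:R * dl * n%:R - M%:R < a n.
    by rewrite ltNge; apply/negP => le; apply: nM; exists n.
  rewrite [i.+1%:R]mulrS; lra.
exists (i%:R * dl) => /=; near=> n.
have n0 : 0 < n%:R :> R by rewrite ltr0n; near: n; exact: nbhs_infty_gt.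
rewrite -ball_normE /=; apply: le_lt_trans ke.
have up : a n < i.+1%:R * dl * n%:R by near: n; exact: aup.
have lo : (i%:R - 2) * dl * n%:R <= a n by near: n.
rewrite ler_distlC; apply/andP; split.
  by rewrite ler_pdivlMr //; lra.
rewrite ler_pdivrMr //; move: up; rewrite [i.+1%:R]mulrS.
have : 0 <= dl * n%:R by rewrite mulr_ge0 // ltW.
lra.
Unshelve. all: by end_near. Qed.

Context d (X : measurableType d) (mu : probability X R) (T : X -> X).
Hypothesis T_mpt : mpt mu T.

(* [E] and [T @^-1` E] have the same measure, so that if one contains the other
   up to a null set then they agree up to a null set. *)
Lemma ae_invariant (E : set X) : measurable E ->
  {ae mu, forall x, E (T x) -> E x} ->
  {ae mu, forall x, E x -> forall k, E (iter k T x)}.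
Proof.
move=> mE TE; have [mT muT] := T_mpt.
have mTE : measurable (T @^-1` E) by rewrite -[X in measurable X]setTI; exact: mT.
have fin (A : set X) : measurable A -> mu A \is a fin_num.
  by move=> mA; exact: fin_num_measure.
have TE0 : mu (T @^-1` E `\` E) = 0%E.
  apply: measure_negligible; first exact: measurableD.
  by apply: negligibleS TE => x [? ?] /=; apply/not_implyP.
have E0 : mu (E `\` T @^-1` E) = 0%E.
  rewrite measureD //; last by rewrite -ge0_fin_numE ?fin.
  move: TE0; rewrite measureD //; last by rewrite -ge0_fin_numE ?fin.
  by move=> <-; rewrite setIC; congr (_ - _)%E; exact/esym/muT.
have {}E0 : {ae mu, forall x, E x -> E (T x)}.
  exists (E `\` T @^-1` E); split=> //; first exact: measurableD.
  by move=> x /= /not_implyP.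
have {}E0 k : {ae mu, forall x, E (iter k T x) -> E (iter k.+1 T x)}.
  have [mTk Tk] := mpt_iter T_mpt k.
  exact: (ae_measure_preserving mTk Tk E0).
move/ae_foralln: E0; apply: filterS => x Ex E0x; elim=> // k IH; exact: Ex.
Qed.

Variable f : nat -> X -> R.
Hypothesis mf : forall n, measurable_fun setT (f n).
Hypothesis f0 : forall n x, 0 <= f n x.
Hypothesis if1 : mu.-integrable setT (EFin \o f 1).
Hypothesis fD : forall k m,
  {ae mu, forall x, f (k + m)%N x <= f k x + f m (iter k T x)}.

Let aefD : {ae mu, forall x, forall k m,
  f (k + m)%N x <= f k x + f m (iter k T x)}.
Proof. by apply: ae_foralln => k; exact: ae_foralln. Qed.

(** Requiring every margin [M], and not just [f m x <= p * m], makes the condition pass from [T x]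
    to [x]: the fixed amount [f 1 x] is absorbed by the margin. Hence [ae_invariant] applies. *)
Lemma ae_no_upcrossing (p q : R) : 0 <= p -> p < q ->
  {ae mu, forall x,
    (forall M : nat, exists2 m, (0 < m)%N & f m x <= p * m%:R - M%:R) ->
    \forall n \near \oo, f n x < q * n%:R}.
Proof.
move=> p0 pq; have [N0 [mN0 muN0 N0P]] := aefD.
have aeN0 : {ae mu, forall x, ~ N0 x}.
  by exists N0; split=> // x /= /contrapT.
pose E : set X := (\bigcap_M \bigcup_(m in [set m | (0 < m)%N])
  [set x | f m x <= p * m%:R - M%:R]) `\` N0.
have good x : ~ N0 x -> forall k m, f (k + m)%N x <= f k x + f m (iter k T x).
  by move=> nx; apply: contrapT => nf; apply: nx; exact: N0P.
have mE : measurable E.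
  apply: measurableD => //; apply: bigcap_measurable => // M _.
  apply: bigcup_measurable => m _.
  exact: measurable_sublevel.
have ET : {ae mu, forall x, E (T x) -> E x}.
  apply: filterS aeN0 => x xN [Tx _]; split=> // M _.
  (* The margin at [T x] is enlarged by more than [f 1 x]. *)
  have [m /= m0 fm] := Tx (M + Num.truncn (f 1 x)).+1 I.
  exists m.+1 => //=; apply: le_trans (good x xN 1 m) _.
  have := truncnS_gt (f 1 x).
  move: fm; rewrite /= -addnS natrD [m.+1%:R]mulrS; lra.
(* [E] is invariant only up to null sets; the orbits that never leave it form an exactly forward
   invariant set, which by [ae_invariant] misses only a null part of [E]. *)
pose D : set X := [set x | forall k, E (iter k T x)].
have mD : measurable D.
  rewrite (_ : D = \bigcap_k (iter k T @^-1` E)).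
    apply: bigcap_measurable => // k _.
    by rewrite -[X in measurable X]setTI; exact: (mpt_iter T_mpt k).1.
  by apply/seteqP; split=> x Dx k; [move=> _|]; exact: Dx.
have DT x : D x -> D (T x) by move=> Dx k; rewrite /= -iterSr; exact: Dx.
have DN x : D x -> ~ N0 x by move=> /(_ 0) [].
have Dp x : D x -> exists2 m, (0 < m)%N & f m x <= p * m%:R.
  by move=> /(_ 0) [/(_ 0 I) [m m0 fm] _]; exists m => //; move: fm; rewrite /= subr0.
have Dq := ae_eventually_lt T_mpt mf f0 if1 mD DT
  (fun k m x Dx => good x (DN x Dx) k m) p0 pq Dp.
have DE := ae_invariant mE ET.
apply: filterS3 aeN0 Dq DE => x xN Dqx DEx xp; apply: Dqx; apply: DEx; split=> // M _.
by have [m m0 fm] := xp M; exists m.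
Qed.

(** Rational rates [i / (k + 1)] suffice, so only countably many null sets are discarded. The linear
    bound comes from [f n <= S_n (f 1)] and [ae_ergodic_sum_le]. *)
Theorem kingman : {ae mu, forall x, cvgn (fun n => f n x / n%:R)}.
Proof.
have up : {ae mu, forall x, forall i k : nat,
    (forall M : nat,
       exists2 m, (0 < m)%N & f m x <= i%:R / k.+1%:R * m%:R - M%:R) ->
    \forall n \near \oo, f n x < i.+1%:R / k.+1%:R * n%:R}.
  apply: ae_foralln => i; apply: ae_foralln => k; apply: ae_no_upcrossing.
    by rewrite divr_ge0.
  by rewrite ltr_pM2r ?invr_gt0 // ltr_nat.
have bd := ae_ergodic_sum_le T_mpt (mf 1) (f0 1) if1.
(* The induction below moves the base point, so subadditivity is required along the whole orbit. *)
have fDT : {ae mu, forall x, forall j k m,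
    f (k + m)%N (iter j T x) <= f k (iter j T x) + f m (iter k T (iter j T x))}.
  apply: ae_foralln => j; have [mTj Tj] := mpt_iter T_mpt j.
  exact: (ae_measure_preserving mTj Tj aefD).
apply: filterS3 up bd fDT => x upx [K Kx] fx.
have le n j : f n.+1 (iter j T x) <= ergodic_sum T (f 1) n.+1 (iter j T x).
  elim: n j => [|n IH] j.
    by rewrite ergodic_sumS /ergodic_sum big_ord0 addr0.
  apply: le_trans (fx j 1 n.+1) _.
  by rewrite ergodic_sumS lerD2l; exact: (IH j.+1).
apply: (@is_cvg_no_upcrossing (f^~ x) K) => // -[//|n] n0.
exact: le_trans (le n 0) (Kx _ n0).
Qed.

End Kingman.

(** * Recurrence to sets where a function is bounded *)

Section Recurrence.
Context {R : realType} d (X : measurableType d) (mu : probability X R) (T : X -> X).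
Hypothesis T_mpt : mpt mu T.

(** If [psi] exceeds [K] from time [N] on, it does so at time [N], an event of measure [mu (U K)] by
    invariance. Letting [N] and then [K] grow leaves a null set. *)
Lemma ae_frequently_bounded (psi : X -> R) : measurable_fun setT psi ->
  {ae mu, forall x, exists K : nat, forall N : nat,
     exists2 n, (N <= n)%N & psi (iter n T x) <= K%:R}.
Proof.
move=> mpsi.
pose U (K : nat) : set X := [set x | K%:R < psi x].
have mU K : measurable (U K).
  by rewrite /U -preimage_itvoy -[X in measurable X]setTI; exact: mpsi.
pose V K N : set X := \bigcap_(n in [set n | (N <= n)%N]) (iter n T @^-1` U K).
have mV K N : measurable (V K N).
  apply: bigcap_measurable => [|n _]; first by exists N => /=.
  by rewrite -[X in measurable X]setTI; exact: (mpt_iter T_mpt n).1.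
pose W K := \bigcup_N V K N.
have mW K : measurable (W K) by apply: bigcup_measurable.
have WU K : (mu (W K) <= mu (U K))%E.
  have : (mu \o V K) N @[N --> \oo] --> mu (W K).
    apply: nondecreasing_cvg_mu => //; first exact: mW.
    move=> N M NM; apply/subsetPset => x Vx n /= Mn.
    by apply: Vx => /=; exact: leq_trans Mn.
  move/cvge_to_le; apply; apply: nearW => N /=.
  rewrite -(proj2 (mpt_iter T_mpt N) _ (mU K)); apply: le_measure; rewrite ?inE //.
    by rewrite -[X in measurable X]setTI; exact: (mpt_iter T_mpt N).1.
  by move=> x /(_ N (leqnn N)).
have capU : \bigcap_K U K = set0.
  apply/seteqP; split=> // x Ux; have := Ux (Num.truncn (psi x)).+1 I.
  by rewrite /U /= ltNge (ltW (truncnS_gt _)).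
have U0 : (mu \o U) K @[K --> \oo] --> 0%E.
  rewrite -(measure0 mu) -capU; apply: nonincreasing_cvg_mu => //.
  - by rewrite -ge0_fin_numE // fin_num_measure.
  - by rewrite capU.
  - move=> K M KM; apply/subsetPset => x; rewrite /U /=.
    by apply: le_lt_trans; rewrite ler_nat.
exists (\bigcap_K W K); split.
- by apply: bigcap_measurable => // K _; exact: mW.
- apply/eqP; rewrite eq_le measure_ge0 andbT.
  apply: (cvge_to_ge U0); apply: nearW => K /=.
  apply: le_trans (WU K); apply: le_measure; rewrite ?inE //.
    by apply: bigcap_measurable => // ? _; exact: mW.
  by move=> x; apply.
- move=> x /= nx K _; apply: contrapT => nW; apply: nx; exists K => N.
  apply: contrapT => nN; apply: nW; exists N => // n /= Nn.
  by rewrite /U /= ltNge; apply/negP => le; apply: nN; exists n.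
Qed.

End Recurrence.

(** * Comparison and measurability of limits *)

Section Limits.
Context {R : realType}.

Lemma limn_div_le (u v w : nat -> R) (C K : R) :
  cvgn (fun n => u n / n%:R) -> cvgn (fun n => v n / n%:R) ->
  (forall n, u n <= C + v n + w n) ->
  (forall N : nat, exists2 n, (N <= n)%N & w n <= K) ->
  limn (fun n => u n / n%:R) <= limn (fun n => v n / n%:R).
Proof.
set a := limn _; set b := limn _ => cu cv uv wK.
(* Three quarters of the gap are spent: one on each limit and one on [(C + K) / n]. *)
rewrite leNgt; apply/negP => ba; pose e := (a - b) / 4.
have e0 : 0 < e by rewrite divr_gt0 // subr_gt0.
have : \forall n \near \oo, [/\ (0 < n)%N, a - e <= u n / n%:R,
    v n / n%:R <= b + e & (C + K) / e <= n%:R].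
  near=> n; split.
  - by near: n; exact: nbhs_infty_gt.
  - have : `|a - u n / n%:R| <= e by near: n; move/cvgrPdist_le : cu; exact.
    by rewrite ler_distlC => /andP[].
  - have : `|b - v n / n%:R| <= e by near: n; move/cvgrPdist_le : cv; exact.
    by rewrite ler_distlC => /andP[].
  - by near: n; exact: nbhs_infty_ger.
move=> [N _ NP]; have [n Nn wn] := wK N.
have [n0 un vn Cn] := NP n Nn.
have {}n0 : 0 < n%:R :> R by rewrite ltr0n.
move: un vn Cn (uv n); rewrite ler_pdivlMr // !ler_pdivrMr // => un vn Cn uvn.
have : 0 < e * n%:R by rewrite mulr_gt0.
have : a * n%:R = b * n%:R + 4 * (e * n%:R) by rewrite /e; field.
lra.
Unshelve. all: by end_near. Qed.

Lemma limn_div_ge0 (u : nat -> R) : (forall n, 0 <= u n) ->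
  0 <= limn (fun n => u n / n%:R).
Proof.
(* Without convergence, [limn] is the default [point], which is [0] here. *)
move=> u0; have [cu|/dvgP ->] := pselect (cvgn (fun n => u n / n%:R)); last first.
  by rewrite /point.
by apply: limr_ge => //; apply: nearW => n; rewrite divr_ge0.
Qed.

Context d (X : measurableType d).
Implicit Types u : nat -> X -> R.

(** The Cauchy criterion with tolerances [1 / (k + 1)] uses only countable operations. *)
Lemma measurable_cvgn u : (forall n, measurable_fun setT (u n)) ->
  measurable [set x | cvgn (u^~ x)].
Proof.
move=> mu.
rewrite (_ : [set _ | _] = \bigcap_k \bigcup_N
    \bigcap_(n in [set n | (N <= n)%N]) [set x | `|u N x - u n x| <= k.+1%:R^-1]).
  apply: bigcap_measurable => // k _; apply: bigcup_measurable => N _.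
  apply: bigcap_measurable => [|n _]; first by exists N => /=.
  apply: measurable_sublevel.
  by apply: measurableT_comp => //; exact: measurable_funB.
apply/seteqP; split=> x.
  move=> /= /cvgrPdist_le cu k _; set dl := k.+1%:R^-1.
  have [|N _ NP] := cu (dl / 2); first by rewrite divr_gt0 // invr_gt0.
  exists N => // n /= Nn; rewrite (splitr dl).
  apply: le_trans (ler_distD (limn (u^~ x)) _ _) _; rewrite lerD //.
    by rewrite distrC; exact: NP N (leqnn N).
  exact: NP n Nn.
move=> /= ux; apply/cauchy_cvgP/cauchy_exP => e e0.
have [N _ NP] := ux (Num.truncn e^-1) I.
exists (u N x); exists N => // n /= Nn; rewrite -ball_normE /=.
apply: le_lt_trans (NP n Nn) _.
by rewrite invf_plt ?posrE // truncnS_gt.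
Qed.

Lemma measurable_limn u : (forall n, measurable_fun setT (u n)) ->
  measurable_fun setT (fun x => limn (u^~ x)).
Proof.
move=> mu; pose C := [set x | cvgn (u^~ x)].
(* Cutting off by [\1_C] makes the sequence converge everywhere; off [C] its limit [0] is the
   default value of [limn]. *)
apply: (@measurable_fun_cvg _ _ _ _ (fun n => u n \* \1_C)) => [n|x _].
  by apply: measurable_funM => //; apply: measurable_indic; exact: measurable_cvgn.
rewrite /= indicE; have [Cx|nCx] := pselect (C x).
  by rewrite mem_set //; under eq_fun do rewrite mulr1.
rewrite memNset // (dvgP nCx); under eq_fun do rewrite mulr0.
exact: cvg_cst.
Qed.

(** Open intervals generate the Borel sets of [R], and their preimages under [theta] are open. *)
Lemma measurable_continuous_borel_meas (G : topologicalType) (phi : X -> G)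
    (theta : G -> R) :
  continuous theta -> borel_meas phi -> measurable_fun setT (theta \o phi).
Proof.
move=> ctheta bphi.
apply: (measurability _ (RGenOpens.measurableE R)) => _ [_ [a [b ->] <-]].
rewrite setTI comp_preimage; apply: bphi.
by move/continuousP : ctheta; apply; exact: interval_open.
Qed.

End Limits.

(** * Cocycles along the powers of one transformation *)

Section Cocycles.
Context {R : realType} d (X : measurableType d) (mu : probability X R).
Variables (Gam : set (X -> X)) (G : topologicalType) (mul : G -> G -> G).
Variables (theta : G -> R) (alpha : X -> (X -> X) -> G) (g : X -> X).
Hypothesis theta_sub : subadditive_fun mul theta.
Hypothesis Gam_aut : aut_subgroup mu Gam.
Hypothesis alpha_cocycle : cocycle mu Gam mul alpha.
Hypothesis Gam_g : Gam g.

Lemma aut_subgroup_iter n : Gam (iter n g).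
Proof.
have [_ [Gid [Gmul _]]] := Gam_aut.
by elim: n => [//|n IH]; exact: (Gmul _ _ IH Gam_g).
Qed.

Lemma aut_subgroup_mpt : mpt mu g.
Proof. by have [/(_ _ Gam_g) [g' [_ [_ []]]]] := Gam_aut. Qed.

Lemma measurable_theta_iter n :
  measurable_fun setT (fun x => theta (alpha x (iter n g))).
Proof.
have [ctheta _] := theta_sub; have [balpha _] := alpha_cocycle.
exact: measurable_continuous_borel_meas ctheta (balpha _ (aut_subgroup_iter n)).
Qed.

Lemma measurable_Theta : measurable_fun setT (Theta theta alpha g).
Proof.
apply: (@measurable_limn _ _ _ (fun n x => theta (alpha x (iter n g)) / n%:R)) => n.
by apply: measurable_funM => //; exact: measurable_theta_iter.
Qed.

Lemma Theta_ge0 x : 0 <= Theta theta alpha g x.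
Proof. by apply: limn_div_ge0 => n; have [_ []] := theta_sub. Qed.

(** The cocycle identity at the powers [k] and [m] of [g], followed by [theta], is the subadditivity
    required by [kingman]. *)
Lemma ae_cvgn_Theta : mu.-integrable setT (fun x => (theta (alpha x g))%:E) ->
  {ae mu, forall x, cvgn (fun n => theta (alpha x (iter n g)) / n%:R)}.
Proof.
move=> ig; have [_ [theta0 thetaD]] := theta_sub.
apply: (kingman aut_subgroup_mpt measurable_theta_iter) => // k m.
have [_ /(_ _ _ (aut_subgroup_iter k) (aut_subgroup_iter m))] := alpha_cocycle.
apply: filterS => x xE; apply: le_trans (thetaD _ _); rewrite -xE.
rewrite (_ : gmul _ _ = iter (k + m) g) //.
by apply/funext => y; rewrite addnC iterD.
Qed.

End Cocycles.

(** * Invariance under weak equivalence *)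

Theorem theorem2 (R : realType) (d1 d2 : measure_display)
    (X1 : measurableType d1) (X2 : measurableType d2)
    (mu1 : probability X1 R) (mu2 : probability X2 R)
    (Gam1 : set (X1 -> X1)) (Gam2 : set (X2 -> X2))
    (G : topologicalType) (mul : G -> G -> G) (inv : G -> G) (one : G)
    (theta : G -> R)
    (alpha1 : X1 -> (X1 -> X1) -> G) (alpha2 : X2 -> (X2 -> X2) -> G)
    (h : X1 -> X2) (hi : X2 -> X1) (gam1 : X1 -> X1) :
  topgroup mul inv one ->
  subadditive_fun mul theta ->
  aut_subgroup mu1 Gam1 -> aut_subgroup mu2 Gam2 ->
  cocycle mu1 Gam1 mul alpha1 -> cocycle mu2 Gam2 mul alpha2 ->
  weakly_equivalent mu1 mu2 Gam1 Gam2 mul inv alpha1 alpha2 h hi ->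
  Gam1 gam1 ->
  mu1.-integrable setT (fun x1 => (theta (alpha1 x1 gam1))%:E) ->
  mu2.-integrable setT (fun x2 => (theta (alpha2 x2 (h \o gam1 \o hi)))%:E) ->
  Theta_mu mu1 theta alpha1 gam1 = Theta_mu mu2 theta alpha2 (h \o gam1 \o hi).
Proof.
move=> tgG theta_sub aut1 aut2 coc1 coc2.
move=> [[hK [hiK [mh [mhi muh]]]] [Gam2E [phi [bphi cohom]]]] Gam_gam1 int1 int2.
set gam2 := h \o gam1 \o hi in int2 *.
have Gam_gam2 : Gam2 gam2 by rewrite Gam2E; exists gam1.
have muhi A : measurable A -> mu2 (hi @^-1` A) = mu1 A.
  move=> mA; rewrite -muh; last by rewrite -[X in measurable X]setTI; exact: mhi.
  by congr (mu1 _); apply/seteqP; split=> x /=; rewrite hK.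
(* Conjugation commutes with powers, so the cohomology relation at [iter n gam2] involves [alpha1]
   at [iter n gam1]. *)
have gam2E n : hi \o iter n gam2 \o h = iter n gam1.
  apply/funext => x /=; elim: n => [|n IH]; first exact: hK.
  by rewrite !iterS -IH /gam2 /= hK.
have [ctheta [theta0 thetaD]] := theta_sub.
have mpt2 := aut_subgroup_mpt aut2 Gam_gam2.
have borel_inv : borel_meas (inv \o phi).
  move=> U oU; rewrite comp_preimage; apply: bphi.
  by move/continuousP : (tg_inv_cont tgG); apply.
(* The factor at the moving point is [phi] when solving for [alpha1] and [inv \o phi] when solving
   for [alpha2]; [theta] need not be symmetric, so both must be bounded infinitely often. *)
have rec := ae_frequently_bounded mpt2
  (measurable_continuous_borel_meas ctheta bphi).
have rec_inv := ae_frequently_bounded mpt2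
  (measurable_continuous_borel_meas ctheta borel_inv).
have cvg1 : {ae mu2, forall y,
    cvgn (fun n => theta (alpha1 (hi y) (iter n gam1)) / n%:R)}.
  exact: (ae_measure_preserving mhi muhi
    (ae_cvgn_Theta theta_sub aut1 coc1 Gam_gam1 int1)).
have cvg2 := ae_cvgn_Theta theta_sub aut2 coc2 Gam_gam2 int2.
have coh : {ae mu2, forall y, forall n, alpha2 y (iter n gam2) =
    mul (mul (phi y) (alpha1 (hi y) (iter n gam1))) (inv (phi (iter n gam2 y)))}.
  apply: ae_foralln => n; have := cohom _ (aut_subgroup_iter aut2 Gam_gam2 n).
  by rewrite /transport gam2E.
have ThetaE : {ae mu2, forall y,
    Theta theta alpha1 gam1 (hi y) = Theta theta alpha2 gam2 y}.
  apply: filterS3 cvg1 cvg2 (filterI coh (filterI rec rec_inv)).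
  move=> y c1 c2 [cohy [[K recy] [K' recy']]]; apply/eqP; rewrite eq_le.
  apply/andP; split.
    apply: (limn_div_le (C := theta (inv (phi y))) c1 c2 _ recy) => n.
    (* The cohomology relation solved for [alpha1]. *)
    have -> : alpha1 (hi y) (iter n gam1) =
        mul (mul (inv (phi y)) (alpha2 y (iter n gam2))) (phi (iter n gam2 y)).
      rewrite cohy !(tg_mulA tgG) (tg_mulVg tgG) (tg_mul1g tgG).
      by rewrite -(tg_mulA tgG) (tg_mulVg tgG) (tg_mulg1 tgG).
    by apply: le_trans (thetaD _ _) _; rewrite lerD2r.
  apply: (limn_div_le (C := theta (phi y)) c2 c1 _ recy') => n.
  by rewrite cohy; apply: le_trans (thetaD _ _) _; rewrite lerD2r.
have mT1 := measurable_Theta theta_sub aut1 coc1 Gam_gam1.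
have mT2 := measurable_Theta theta_sub aut2 coc2 Gam_gam2.
have T1ge0 := Theta_ge0 alpha1 gam1 theta_sub.
have T2ge0 := Theta_ge0 alpha2 gam2 theta_sub.
rewrite /Theta_mu.
(* Both functions are nonnegative and measurable, so the change of variables and the almost
   everywhere comparison need no integrability of [Theta]. *)
rewrite -(ge0_integral_measure_preserving mhi muhi
  (f := fun x => (Theta theta alpha1 gam1 x)%:E)) //; last 1 first.
- by apply/measurable_EFinP.
apply: ge0_ae_eq_integral => //.
- by apply/measurable_EFinP; exact: measurableT_comp mT1 mhi.
- by apply/measurable_EFinP.
- by move=> y _; rewrite lee_fin.
- by move=> y _; rewrite lee_fin.
- by apply: filterS ThetaE => y yE _ /=; rewrite yE.
Qed.
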